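(* Let $k\ge2$. Every inhomogeneous $k$-Becker function is $k$-regular.
   Context: An inhomogeneous $k$-Becker function is an analytic function $f\in\mathbb{C}[[q]]$ (a power series converging near $0$) for which there are $d\ge0$ and polynomials $A,A_0,A_1,\dots,A_d\in\mathbb{C}[q]$ with $A_0=1$, $A_d\ne0$ and $$A(q)+f(q)+A_1(q)f(q^k)+\dots+A_d(q)f(q^{k^d})=0$$ ($A$ is not required to be zero). The $k$-kernel of a sequence $(x_n)_{n\ge0}$ is the set of all subsequences $(x_{k^en+r})_{n\ge0}$ with $e\ge0$ and $0\le r\le k^e-1$. A complex sequence is $k$-regular if its $k$-kernel is finitely generated, i.e. its $k$-kernel spans a finite-dimensional $\mathbb{C}$-vector space. A power series is $k$-regular if its coefficient sequence is. *)

(* Defs.v *)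
From mathcomp Require Import all_boot all_order all_algebra complex.
From mathcomp Require Import all_classical all_reals all_analysis.
Import numFieldNormedType.Exports.
Import Order.TTheory GRing.Theory Num.Theory.

Set Implicit Arguments.
Unset Strict Implicit.
Unset Printing Implicit Defensive.

Local Open Scope classical_set_scope.
Local Open Scope ring_scope.
Local Open Scope complex_scope.

(* Packaging R[i] as a numClosedFieldType gives it the topology induced by the
   modulus, which is not found on the bare type R[i]. *)
Definition Cplx (R : realType) : numClosedFieldType := R[i].

(* A power series, an element of C[[q]], is given by its coefficient sequence
   f : nat -> Cplx R. *)
Definition power_series_sum (R : realType) (f : nat -> Cplx R) (q : Cplx R) :
    Cplx R :=
  limn [series f n * q ^+ n]_n.

Definition converges_near0 (R : realType) (f : nat -> Cplx R) : Prop :=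
  \forall q \near (0 : Cplx R), cvgn [series f n * q ^+ n]_n.

Definition inhomogeneous_Becker (R : realType) (k : nat) (f : nat -> Cplx R) :
    Prop :=
  converges_near0 f /\
  exists (d : nat) (A : {poly Cplx R}) (a : nat -> {poly Cplx R}),
    [/\ a 0%N = 1, a d != 0 &
      \forall q \near (0 : Cplx R),
        A.[q] + \sum_(i < d.+1) (a i).[q] * power_series_sum f (q ^+ (k ^ i)%N)
          = 0].

Definition kernel_seq (T : Type) (k : nat) (x : nat -> T) : set (nat -> T) :=
  [set y | exists e r : nat,
     (r < k ^ e)%N /\ y = (fun n => x (k ^ e * n + r)%N)].

(* The library's span and \dim only cover finite sequences of vectors in a
   space that is already finite dimensional. *)
Definition linear_span (K : fieldType) (V : lmodType K) (S : set V) : set V :=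
  [set v | exists (n : nat) (c : 'I_n -> K) (s : 'I_n -> V),
     (forall i, S (s i)) /\ v = \sum_(i < n) c i *: s i].

Definition finite_dimensional (K : fieldType) (V : lmodType K) (W : set V) :
    Prop :=
  exists (m : nat) (b : 'I_m -> V), W = linear_span (range b).

(* A power series is regular when its coefficient sequence is, so this applies
   to both. *)
Definition regular_seq (R : realType) (k : nat) (x : nat -> Cplx R) : Prop :=
  @finite_dimensional (Cplx R) (nat -> Cplx R : lmodType (Cplx R))
    (linear_span (kernel_seq k x)).

(* Main.v *)
Require Import Defs.
From mathcomp Require Import all_boot all_order all_algebra complex.
From mathcomp Require Import all_classical all_reals all_analysis.
Import numFieldNormedType.Exports.
Import Order.TTheory GRing.Theory Num.Theory.

(** Write delta for the sequence 1, 0, 0, ... and read sequences as power series: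
    shifting by j is multiplication by q^j, dilating by m is the substitution of
    q^m for q, and D_r, which takes (x_n) to (x_(kn+r)), is the decimation
    operator whose iterates with r < k produce the whole k-kernel.

    The functional equation is first turned into an identity of formal power
    series ([Becker_coef]). Near 0 the sum of a convergent series differs from
    its N-th partial sum by O(q^N) ([power_series_expansion]). Replacing each
    f(q^(k^i)) in the equation by a partial sum thus gives a polynomial that is
    O(q^N) at 0, and such a polynomial has no coefficients below N
    ([vanishing_poly_coef]). As A_0 = 1, the resulting identity expresses f as a
    combination of sequences q^l and q^l f(q^(k^i)) with 1 <= i <= d and l < H,
    where H bounds the number of coefficients of each of A, A_0, ..., A_d.

    Consider the space W spanned by q^j and q^j f(q^(k^i)) with j < H and
    i <= d. It is stable under every D_r. If i >= 1, or for pure monomials, D_r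
    kills q^j g(q^k) unless j = r mod k, and then it yields q^(j div k) g(q)
    ([decimate_shift_dilate]), so the exponent drops and one power of k is lost.
    If i = 0, the identity rewrites q^j f in terms of q^j' and q^j' f(q^(k^i))
    with i >= 1 and j' < 2H; since k >= 2, dividing j' by k brings it back below
    H. Hence W contains the k-kernel of f ([recurrence_finite_dimensional]).
    It remains to see that a set of vectors inside a finitely generated space
    spans a finitely generated space ([finite_dimensional_linear_span]). *)

Set Implicit Arguments.
Unset Strict Implicit.
Unset Printing Implicit Defensive.

Local Open Scope classical_set_scope.
Local Open Scope ring_scope.

(** * Spans inside a finitely generated space *)

Section LinearSpan.
Variables (K : fieldType) (V : lmodType K).
Implicit Types (S : set V) (v : V).

Lemma linear_span_incl S : S `<=` linear_span S.
Proof.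
move=> v Sv; exists 1%N, (fun=> 1), (fun=> v).
by rewrite big_ord1 scale1r.
Qed.

Lemma linear_spanD S u v :
  linear_span S u -> linear_span S v -> linear_span S (u + v).
Proof.
move=> [n1 [c1 [s1 [S1 ->]]]] [n2 [c2 [s2 [S2 ->]]]].
pose glue T (g1 : 'I_n1 -> T) (g2 : 'I_n2 -> T) i :=
  match fintype.split i with inl i1 => g1 i1 | inr i2 => g2 i2 end.
exists (n1 + n2)%N, (glue _ c1 c2), (glue _ s1 s2); split.
  by move=> i; rewrite /glue; case: fintype.split.
rewrite big_split_ord; congr (_ + _); apply: eq_bigr => i _.
  by rewrite /glue -[lshift _ _]/(unsplit (inl i)) unsplitK.
by rewrite /glue -[rshift _ _]/(unsplit (inr i)) unsplitK.
Qed.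

Lemma linear_spanZ S a v : linear_span S v -> linear_span S (a *: v).
Proof.
move=> [n [c [s [Ss ->]]]]; exists n, (fun i => a * c i), s; split=> //.
by rewrite scaler_sumr; apply: eq_bigr => i _; rewrite scalerA.
Qed.

Lemma linear_span0 S : linear_span S 0.
Proof.
by exists 0%N, (fun=> 0), (fun=> 0); split=> [[]//|]; rewrite big_ord0.
Qed.

Lemma linear_span_sum S (I : Type) (r : seq I) (P : pred I) (F : I -> V) :
  (forall i, P i -> linear_span S (F i)) ->
  linear_span S (\sum_(i <- r | P i) F i).
Proof.
move=> SF; apply: big_ind => //; first exact: linear_span0.
exact: linear_spanD.
Qed.

Lemma linear_span_min S S' :
  S `<=` linear_span S' -> linear_span S `<=` linear_span S'.
Proof.
move=> SS' v [n [c [s [Ss ->]]]].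
by apply: linear_span_sum => i _; apply/linear_spanZ/SS'.
Qed.

(** Indexing the coefficients by the generating family itself bounds their number
    uniformly in the vector, which is what allows coordinates in a fixed row
    space. *)
Lemma linear_span_range (T : finType) (b : T -> V) v :
  linear_span (range b) v -> exists c : T -> K, v = \sum_t c t *: b t.
Proof.
move=> [n [c [s [Ss ->]]]].
have /choice[g gE] : forall i, exists t, b t = s i.
  by move=> i; have [t _ <-] := Ss i; exists t.
exists (fun t => \sum_(i | g i == t) c i).
rewrite (partition_big g predT)//=; apply: eq_bigr => t _.
by rewrite scaler_suml; apply: eq_bigr => i /eqP <-; rewrite gE.
Qed.

(** Among the square matrices whose rows are coordinates of vectors of the span
    of S, take one of maximal rank. No vector of S can enlarge its row space, so
    the vectors given by its rows generate the span of S. *)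
Lemma finite_dimensional_linear_span (T : finType) (b : T -> V) S :
  S `<=` linear_span (range b) -> finite_dimensional (linear_span S).
Proof.
move=> Sb; pose m := #|T|.
pose comb (c : 'rV[K]_m) : V := \sum_t c 0 (enum_rank t) *: b t.
have combD c c' : comb (c + c') = comb c + comb c'.
  rewrite /comb -big_split; apply: eq_bigr => t _ /=.
  by rewrite mxE scalerDl.
have combZ a c : comb (a *: c) = a *: comb c.
  rewrite /comb scaler_sumr; apply: eq_bigr => t _ /=.
  by rewrite mxE scalerA.
have comb0 : comb 0 = 0 by rewrite -(scale0r 0) combZ scale0r.
have comb_mul n (w : 'rV[K]_n) (M : 'M[K]_(n, m)) :
    comb (w *m M) = \sum_j w 0 j *: comb (row j M).
  rewrite mulmx_sum_row (big_morph comb combD comb0).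
  by apply: eq_bigr => j _; rewrite combZ.
pose realized r := `[< exists M : 'M[K]_m,
  (forall i, linear_span S (comb (row i M))) /\ \rank M = r >].
have exr : exists r, realized r.
  exists 0%N; apply/asboolP; exists 0; split; last by rewrite mxrank0.
  by move=> i; rewrite row0 comb0; exact: linear_span0.
have ler r : realized r -> (r <= m)%N.
  by move=> /asboolP[M [_ <-]]; exact: rank_leq_row.
have [r /asboolP[M [SM rM]] rmax] := ex_maxnP exr ler.
exists m, (fun j => comb (row j M)); apply/seteqP; split.
  apply: linear_span_min => v Sv.
  have [c vE] := linear_span_range (Sb v Sv).
  pose c' : 'rV[K]_m := \row_j c (enum_val j).
  have {vE} vE : v = comb c'.
    by rewrite vE; apply: eq_bigr => t _; rewrite mxE enum_rankK.
  have c'M : (c' <= M)%MS.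
    apply: submx_trans (addsmxSr M c') _.
    rewrite -(geq_leqif (mxrank_leqif_sup (addsmxSl M c'))) rM.
    apply: rmax; apply/asboolP; exists (M + c')%MS; split=> // i.
    have /sub_addsmxP[[u1 u2] /= ->] := row_sub i (M + c')%MS.
    rewrite combD !comb_mul; apply: linear_spanD; apply: linear_span_sum.
      by move=> j _; apply: linear_spanZ.
    move=> j _; apply: linear_spanZ; rewrite ord1 row_id -vE.
    exact: linear_span_incl.
  rewrite vE; have /submxP[w ->] := c'M; rewrite comb_mul.
  apply: linear_span_sum => j _; apply: linear_spanZ.
  by apply: linear_span_incl; exists j.
by apply: linear_span_min => _ [j _ <-].
Qed.

End LinearSpan.

(** * Decimation, shift and dilation of sequences *)

Section SequenceOperators.
Variable V : nmodType.
Implicit Types x y : nat -> V.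

(** This is the Cartier operator of index r on power series. *)
Definition decimate k r x : nat -> V := fun n => x (k * n + r)%N.

Definition dilate m x : nat -> V :=
  fun n => if (m %| n)%N then x (n %/ m)%N else 0.

Definition shift j x : nat -> V :=
  fun n => if (n < j)%N then 0 else x (n - j)%N.

(** Reading the base k digits of r from the least significant one writes each
    element of the k-kernel as an iterated decimation of x. *)
Lemma kernel_seq_sub k (W : set (nat -> V)) x : (0 < k)%N ->
  (forall r y, (r < k)%N -> W y -> W (decimate k r y)) ->
  W x -> kernel_seq k x `<=` W.
Proof.
move=> k0 Wsec Wx _ [e [r [+ ->]]].
elim: e r => [|e IHe] r.
  rewrite expn0 ltnS leqn0 => /eqP ->.
  by under eq_fun do rewrite mul1n addn0.
rewrite expnSr => rk; have ke0 : (0 < k ^ e)%N by rewrite expn_gt0 k0.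
have := Wsec (r %/ k ^ e)%N _ _ (IHe (r %% k ^ e)%N (ltn_pmod _ ke0)).
rewrite ltn_divLR// mulnC => /(_ rk); congr W.
apply/funext => n; rewrite /decimate mulnDr -addnA mulnA; congr (x (_ + _)%N).
by rewrite mulnC -divn_eq.
Qed.

(** In series terms this is D_r (q^j g(q^k)) = D_r(q^j) g(q): only the exponents
    congruent to r modulo k survive. The condition r < k ensures that these
    exponents are at least r, so that the quotient j %/ k is the right shift. *)
Lemma decimate_shift_dilate k m j r x : (r < k)%N ->
  decimate k r (shift j (dilate (k * m) x)) =
  if (j %% k == r)%N then shift (j %/ k) (dilate m x) else 0.
Proof.
move=> rk; have k0 : (0 < k)%N by apply: leq_ltn_trans rk.
apply/funext => n; rewrite /decimate /shift /dilate.
case: eqP => [jr|jr].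
  have jE : j = (k * (j %/ k) + r)%N by rewrite mulnC -jr -divn_eq.
  rewrite {1 2 3}jE ltn_add2r ltn_pmul2l// subnDr -mulnBr.
  by rewrite dvdn_pmul2l// divnMl.
rewrite -[RHS]/(0 : V); case: ltnP => // jn.
case: ifP => // /(dvdn_trans (dvdn_mulr m (dvdnn k)))/eqP kd.
case: jr; have : (j + (k * n + r - j) = j %[mod k])%N.
  by rewrite -modnDmr kd addn0.
by rewrite subnKC// mulnC modnMDl (modn_small rk) => ->.
Qed.

Lemma decimate_sum k r (I : Type) (s : seq I) (P : pred I) (F : I -> nat -> V) :
  decimate k r (\sum_(i <- s | P i) F i) = \sum_(i <- s | P i) decimate k r (F i).
Proof. by apply: (big_morph (decimate k r)). Qed.

Lemma shiftD j x y : shift j (x + y) = shift j x + shift j y.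
Proof.
by apply/funext => n; rewrite /shift !fctE; case: ifP => _; rewrite ?addr0.
Qed.

Lemma shift_sum j (I : Type) (s : seq I) (P : pred I) (F : I -> nat -> V) :
  shift j (\sum_(i <- s | P i) F i) = \sum_(i <- s | P i) shift j (F i).
Proof.
apply: (big_morph (shift j) (shiftD j)).
by apply/funext => n; rewrite /shift; case: ifP.
Qed.

Lemma shift_shift j l x : shift j (shift l x) = shift (j + l) x.
Proof.
apply/funext => n; rewrite /shift subnDA.
case: ltnP => [nj|jn]; first by rewrite (leq_trans nj)// leq_addr.
by rewrite ltn_subLR.
Qed.

Lemma shift0 x : shift 0 x = x.
Proof. by apply/funext => n; rewrite /shift ltn0 subn0. Qed.

Lemma dilate1 x : dilate 1 x = x.
Proof. by apply/funext => n; rewrite /dilate dvd1n divn1. Qed.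

End SequenceOperators.

(** * A formal recurrence forces regularity *)

Section Regularity.
Variable K : fieldType.
Implicit Types x y : nat -> K^o.

Definition delta0 : nat -> K^o := fun n => (n == 0%N)%:R.

Lemma decimateZ k r a x : decimate k r (a *: x) = a *: decimate k r x.
Proof. by []. Qed.

Lemma shiftZ j a x : shift j (a *: x) = a *: shift j x.
Proof.
apply/funext => n; rewrite /shift !fctE; case: ifP => _ //.
by rewrite scaler0.
Qed.

(** The constant series 1 is invariant under q -> q^m; this lets monomials be
    treated as instances of q^j g(q^k). *)
Lemma dilate_delta0 m : (0 < m)%N -> dilate m delta0 = delta0.
Proof.
move=> m0; apply/funext => n; rewrite /dilate /delta0.
case: ifPn => [/dvdnP[q ->]|]; first by rewrite mulnK// muln_eq0 (gtn_eqF m0) orbF.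
by case: n => //; rewrite dvdn0.
Qed.

(** The space spanned by the shifts by j < H of delta and of f(q^(k^i)), i <= d,
    is stable under decimation, because one use of the recurrence at most doubles
    the shift while decimation divides it by k >= 2. *)
Lemma recurrence_finite_dimensional k d H (c : 'I_H -> K)
    (a : 'I_d -> 'I_H -> K) x : (2 <= k)%N ->
  x = \sum_l c l *: shift l delta0 +
      \sum_i \sum_l a i l *: shift l (dilate (k ^ i.+1) x) ->
  finite_dimensional (linear_span (kernel_seq k x) : set (nat -> K^o)).
Proof.
move=> k2 xE; have k0 : (0 < k)%N by apply: ltnW.
have [H0|H0] := posnP H.
  subst H; apply: (finite_dimensional_linear_span (b := fun t : 'I_0 => 0)).
  have x0 : x = 0.
    rewrite xE big_ord0 add0r big1// => i _; exact: big_ord0.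
  move=> _ [e [r [_ ->]]]; rewrite x0; exact: linear_span0.
(* None indexes the pure monomials, Some i the multiples of f(q^(k^i)). *)
pose base o := if o is Some i then dilate (k ^ i) x else delta0.
pose b (t : option 'I_d.+1 * 'I_H) := shift t.2 (base (omap val t.1)).
apply: (@finite_dimensional_linear_span _ _ _ b).
have bP o j : (j < H)%N -> (if o is Some i then i <= d else true)%N ->
    linear_span (range b) (shift j (base o)).
  move=> jH; case: o => [i id|_]; apply: linear_span_incl.
    by exists (Some (Ordinal (id : i < d.+1)%N), Ordinal jH).
  by exists (None, Ordinal jH).
have halfH j : (j < 2 * H)%N -> (j %/ k < H)%N.
  by move=> jH; rewrite ltn_divLR// mulnC (leq_trans jH)// leq_mul2r k2 orbT.
have sec_delta r j : (r < k)%N -> (j < 2 * H)%N ->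
    linear_span (range b) (decimate k r (shift j delta0)).
  move=> rk jH; have k10 : (0 < k * 1)%N by rewrite muln1.
    rewrite -(dilate_delta0 k10).
  rewrite decimate_shift_dilate// dilate1; case: ifP => _.
    exact: (bP None _ (halfH _ jH) isT).
  exact: linear_span0.
have sec_dil r i j : (r < k)%N -> (j < 2 * H)%N -> (i < d)%N ->
    linear_span (range b) (decimate k r (shift j (dilate (k ^ i.+1) x))).
  move=> rk jH id; rewrite expnS decimate_shift_dilate//; case: ifP => _.
    exact: (bP (Some i) _ (halfH _ jH) (ltnW id)).
  exact: linear_span0.
have addH (j l : 'I_H) : (j + l < 2 * H)%N.
  by rewrite mul2n -addnn -addnS leq_add// ltnW.
apply: kernel_seq_sub => //; last first.
  by have := bP (Some 0%N) 0%N H0 isT; rewrite /base expn0 dilate1 shift0.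
move=> r y rk [n [s [v [vb ->]]]].
rewrite decimate_sum; apply: linear_span_sum => i _.
rewrite decimateZ; apply: linear_spanZ.
have [[[[[|i'] id]|] j] _ <-] := vb i; rewrite /b /=.
(* The generator q^j f is not of the form q^j g(q^k): expand f first. *)
- rewrite dilate1 xE.
  rewrite shiftD -[decimate _ _ _]/(decimate _ _ _ + decimate _ _ _).
  apply: linear_spanD; rewrite shift_sum decimate_sum; apply: linear_span_sum => l _.
    rewrite shiftZ decimateZ shift_shift; apply/linear_spanZ/sec_delta => //.
  rewrite shift_sum decimate_sum; apply: linear_span_sum => l' _.
  by rewrite shiftZ decimateZ shift_shift; apply/linear_spanZ/sec_dil.
- by apply: sec_dil => //; rewrite mul2n -addnn ltn_addr.
- by apply: sec_delta => //; rewrite mul2n -addnn ltn_addr.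
Qed.

End Regularity.

(** * Order of vanishing at the origin *)

Section Germs.
Variable K : numFieldType.
Implicit Types (g h : K -> K) (p : {poly K}) (f : nat -> K) (q M : K).

(** The origin is excluded so that an estimate for p * 'X can be divided by 'X
    without first knowing the value of p at 0. *)
Definition vanishes_to_order N g : Prop :=
  exists2 M, 0 <= M & \forall q \near (0 : K), q != 0 -> `|g q| <= M * `|q| ^+ N.

Lemma near0P (P : K -> Prop) :
  (\forall q \near (0 : K), P q) <->
  exists2 e : K, 0 < e & forall q, `|q| < e -> P q.
Proof. exact: nbhs_norm0P. Qed.

Lemma near0_lt (e : K) : 0 < e -> \forall q \near (0 : K), `|q| < e.
Proof. by move=> e0; apply/near0P; exists e. Qed.

Lemma vanishes_near_eq N g h : (\forall q \near (0 : K), g q = h q) ->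
  vanishes_to_order N g -> vanishes_to_order N h.
Proof.
move=> gh [M M0 gM]; exists M => //.
by apply: filterS2 gh gM => q ->.
Qed.

Lemma vanishesD N g h : vanishes_to_order N g -> vanishes_to_order N h ->
  vanishes_to_order N (fun q => g q + h q).
Proof.
move=> [M M0 gM] [M' M'0 hM']; exists (M + M'); first exact: addr_ge0.
apply: filterS2 gM hM' => q gq hq q0.
by rewrite (le_trans (ler_normD _ _))// mulrDl lerD ?gq ?hq.
Qed.

Lemma vanishes_sum N (I : Type) (s : seq I) (G : I -> K -> K) :
  (forall i, vanishes_to_order N (G i)) ->
  vanishes_to_order N (fun q => \sum_(i <- s) G i q).
Proof.
move=> GN; elim: s => [|i s IHs].
  exists 0 => //; apply/near0P; exists 1 => // q _ _.
  by rewrite big_nil normr0 mul0r.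
apply: vanishes_near_eq (vanishesD (GN i) IHs).
by apply/near0P; exists 1 => // q _; rewrite big_cons.
Qed.

Lemma horner_bounded p : exists2 M, 0 <= M &
  forall q, `|q| <= 1 -> `|p.[q]| <= M.
Proof.
exists (\sum_(i < size p) `|p`_i|); first exact: sumr_ge0.
move=> q q1; rewrite horner_coef (le_trans (ler_norm_sum _ _ _))//.
apply: ler_sum => i _; rewrite normrM normrX ler_piMr//.
exact: exprn_ile1.
Qed.

Lemma vanishes_hornerM N p g : vanishes_to_order N g ->
  vanishes_to_order N (fun q => p.[q] * g q).
Proof.
move=> [M M0 gM]; have [B B0 pB] := horner_bounded p.
exists (B * M); first exact: mulr_ge0.
apply: filterS2 gM (near0_lt ltr01) => q gq /ltW q1 q0.
by rewrite normrM -mulrA ler_pM ?pB ?gq.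
Qed.

Lemma vanishes_comp_Xn N m g : (0 < m)%N -> vanishes_to_order N g ->
  vanishes_to_order N (fun q => g (q ^+ m)).
Proof.
move=> m0 [M M0 /near0P[e e0 gM]]; exists M => //.
apply: filterS2 (near0_lt e0) (near0_lt ltr01) => q qe /ltW q1 q0.
have qm : `|q ^+ m| <= `|q| by rewrite normrX ler_iXnr.
rewrite (le_trans (gM _ (le_lt_trans qm qe) _)) ?expf_neq0//.
by rewrite ler_wpM2l// lerXn2r ?nnegrE.
Qed.

(** The constant coefficient is O(q), hence zero; dividing by 'X then lowers both
    the order and the index by one. *)
Lemma vanishing_poly_coef N p i : vanishes_to_order N (horner p) ->
  (i < N)%N -> p`_i = 0.
Proof.
elim: N p i => // N IHN p i [M M0 pM].
have [p1 [c pE]] : exists p1 c, p = p1 * 'X + c%:P.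
  by elim/poly_ind: p {pM} => [|p1 c _]; [exists 0, 0|exists p1, c];
    rewrite ?mul0r ?addr0.
have c0 : c = 0.
  have [B B0 p1B] := horner_bounded p1.
  apply/eqP/negP => /negP c0.
  have MB : 0 < M + B + 1 by rewrite ltr_wpDl// addr_ge0.
  have cMB : 0 < `|c| / (M + B + 1) by rewrite divr_gt0 ?normr_gt0.
  have [e e0 pe] : exists2 e : K, 0 < e & forall q, `|q| < e -> q = 0.
    apply/near0P; apply: filterS3 pM (near0_lt ltr01) (near0_lt cMB).
    move=> q pq /ltW q1; rewrite ltr_pdivlMr// => qc.
    apply: contraTeq qc => q0; rewrite -real_leNgt ?normr_real//; last first.
      by rewrite ger0_real// mulr_ge0// ltW.
    have cE : c = p.[q] - p1.[q] * q by rewrite pE !hornerE addrC addKr.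
    rewrite cE (le_trans (ler_normB _ _))// [leRHS]mulrC 2!mulrDl -addrA lerD//.
      by rewrite (le_trans (pq q0))// ler_wpM2l// ler_iXnr.
    by rewrite ler_wpDr ?mulr_ge0// normrM ler_wpM2r// p1B.
  have : e / 2 = 0.
    apply: pe; rewrite gtr0_norm ?divr_gt0// ltr_pdivrMr// mulr_natr mulr2n.
    by rewrite ltrDl.
  by apply/eqP; rewrite gt_eqF// divr_gt0.
have p1N : vanishes_to_order N (horner p1).
  exists M => //; apply: filterS pM => q pq q0; have := pq q0.
  rewrite pE c0 addr0 !hornerE normrM exprSr mulrA ler_pM2r//.
  by rewrite normr_gt0.
rewrite pE c0 addr0 coefMX; case: i => //= i; exact: IHN.
Qed.

(** Convergence at one point r bounds f n * r ^ n, and for |q| <= r / 2 the tail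
    is dominated by a geometric series of ratio at most 1/2. The
    bound is uniform in the length of the partial sum, so it passes to the limit. *)
Lemma power_series_expansion f N :
  (\forall q \near (0 : K), cvgn [series f n * q ^+ n]_n) ->
  vanishes_to_order N
    (fun q => limn [series f n * q ^+ n]_n - (\poly_(n < N) f n).[q]).
Proof.
move=> /near0P[e e0 fe].
have rE : 0 < e / 2 by rewrite divr_gt0.
set r := e / 2 in rE.
have [M M0 fM] : exists2 M, 0 <= M & forall n, `|f n| * r ^+ n <= M.
  have re : `|r| < e.
    by rewrite gtr0_norm// ltr_pdivrMr// mulr_natr mulr2n ltrDl.
  have /cvg_series_cvg_0 cvg0 := fe r re.
  have /cvg_seq_bounded[A [Ar AM]] : cvgn (fun n => f n * r ^+ n).
    by apply/cvg_ex; exists 0.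
  exists (`|A| + 1); first by rewrite addr_ge0.
  move=> n; have := AM (`|A| + 1) _ n I.
  rewrite /= normrM normrX [`|r|]gtr0_norm//; apply.
  by rewrite (le_lt_trans (real_ler_norm Ar))// ltrDl.
exists (2 * M / r ^+ N); first by rewrite divr_ge0 ?mulr_ge0// exprn_ge0// ltW.
apply: filterS (near0_lt (divr_gt0 rE (ltr0n K 2))) => q qr.
rewrite -/r in qr *; move=> _.
have r2 : r / 2 < r by rewrite ltr_pdivrMr// mulr_natr mulr2n ltrDl.
have re : r < e by rewrite ltr_pdivrMr// mulr_natr mulr2n ltrDl.
have qe : `|q| < e by rewrite (lt_trans qr)// (lt_trans r2).
pose t := `|q| / r.
have t0 : 0 <= t by rewrite divr_ge0// ltW.
have t2 : t <= 1 / 2.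
  by rewrite ler_pdivrMr// mul1r mulrC ltW.
have fq n : `|f n * q ^+ n| <= M * t ^+ n.
  have -> : `|f n * q ^+ n| = `|f n| * r ^+ n * t ^+ n.
    by rewrite -mulrA -exprMn [r * t]mulrC divfK ?gt_eqF// normrM normrX.
  by rewrite ler_wpM2r ?exprn_ge0.
have geo N' m : \sum_(N' <= n < N' + m) t ^+ n <= 2 * t ^+ N'.
  (* With the next term counted twice, the bound is preserved by induction. *)
  suff : \sum_(N' <= n < N' + m) t ^+ n + 2 * t ^+ (N' + m) <= 2 * t ^+ N'.
    by apply: le_trans; rewrite lerDl mulr_ge0// exprn_ge0.
  elim: m => [|m IHm]; first by rewrite addn0 big_geq// add0r.
  apply: le_trans IHm; rewrite addnS big_nat_recr ?leq_addr//= -addrA lerD2l.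
  rewrite exprSr mulrCA [leRHS]mulr_natl mulr2n lerD2l ler_piMr ?exprn_ge0//.
  by rewrite mulrC -ler_pdivlMr.
have tail m : (N <= m)%N ->
    `|[series f n * q ^+ n]_n m - (\poly_(n < N) f n).[q]| <=
    2 * M / r ^+ N * `|q| ^+ N.
  move=> Nm; rewrite horner_poly seriesEnat /= -(big_mkord xpredT (fun n => f n * q ^+ n)).
  rewrite (big_cat_nat _ Nm)//= addrAC subrr add0r.
  rewrite (le_trans (ler_norm_sum _ _ _))//.
  rewrite (@le_trans _ _ (\sum_(N <= n < m) M * t ^+ n))//.
    by apply: ler_sum => n _; exact: fq.
  rewrite -mulr_sumr -(subnKC Nm) (le_trans (ler_wpM2l M0 (geo _ _)))//.
  rewrite /t expr_div_n; rewrite le_eqVlt; apply/orP; left; apply/eqP.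
  by rewrite mulrCA mulrA -!mulrA [_^-1 * _]mulrC.
apply/ler_addgt0Pr => d d0.
have /cvgrPdist_lt/(_ d d0) [m _ mP] := fe q qe.
have := mP (maxn m N) (leq_maxl _ _); set s := series _ _ => sd.
set l := limn _ in sd *.
rewrite -(subrKA s) addrC (le_trans (ler_normD _ _))// lerD ?tail ?leq_maxr//.
exact: ltW.
Qed.

End Germs.


(** * From the functional equation to a recurrence *)

Section BeckerCoefficients.
Variable K : numFieldType.
Implicit Types (p P A : {poly K}) (f : nat -> K).

Lemma coefM_shift H p P n : (size p <= H)%N ->
  (p * P)`_n = \sum_(l < H) p`_l * shift l (fun i => P`_i) n.
Proof.
move=> pH; have pE : p = \sum_(l < H) p`_l *: 'X^l.
  rewrite -poly_def; apply/polyP => i; rewrite coef_poly; case: ltnP => // Hi.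
  by rewrite nth_default// (leq_trans pH).
rewrite {1}pE mulr_suml coef_sum; apply: eq_bigr => l _.
by rewrite -scalerAl coefZ coefXnM.
Qed.

(** To reach the coefficient of index n it suffices to replace the sum of the
    series by its partial sum of degree at most n. The polynomial so obtained is
    a combination of the remainders, hence O(q^(n+1)). *)
Lemma Becker_coef k d A (a : nat -> {poly K}) f H n : (0 < k)%N ->
  (forall i : 'I_d.+1, size (a i) <= H)%N ->
  (\forall q \near (0 : K), cvgn [series f n * q ^+ n]_n) ->
  (\forall q \near (0 : K), A.[q] + \sum_(i < d.+1) (a i).[q] *
     limn [series f n * (q ^+ (k ^ i)%N) ^+ n]_n = 0) ->
  A`_n + \sum_(i < d.+1) \sum_(l < H)
    (a i)`_l * shift l (dilate (k ^ i) f) n = 0.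
Proof.
move=> k0 aH fcvg eqn.
pose P := \poly_(j < n.+1) f j.
pose Q := A + \sum_(i < d.+1) a i * (P \Po 'X^(k ^ i)).
have ki0 i : (0 < k ^ i)%N by rewrite expn_gt0 k0.
have : Q`_n = 0.
  apply: (@vanishing_poly_coef _ n.+1) => //.
  pose F q := limn [series f n * q ^+ n]_n - P.[q].
  apply: (@vanishes_near_eq _ _
    (fun q => \sum_(i < d.+1) (- a i).[q] * F (q ^+ (k ^ i)))).
    apply: filterS eqn => q; set s := (X in A.[q] + X) => qE.
    transitivity (Q.[q] - (A.[q] + s)); last by rewrite qE subr0.
    rewrite /Q hornerD horner_sum opprD addrACA subrr add0r.
    rewrite -sumrB; apply: eq_bigr => i _.
    by rewrite hornerM horner_comp hornerXn hornerN mulNr -mulrN opprB mulrBr.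
  apply: vanishes_sum => i; apply: vanishes_hornerM; apply: vanishes_comp_Xn => //.
  exact: power_series_expansion.
move=> Qn; rewrite -[RHS]Qn coefD coef_sum; congr (_ + _); apply: eq_bigr => i _.
rewrite (coefM_shift _ _ (aH i)); apply: eq_bigr => l _; congr (_ * _).
rewrite /shift; case: ltnP => // ln; rewrite coef_comp_poly_Xn// /dilate.
by case: ifP => // _; rewrite coef_poly ltnS (leq_trans (leq_div _ _))// leq_subr.
Qed.

End BeckerCoefficients.

Theorem proposition3p1p6 (R : realType) (k : nat) (hk : (2 <= k)%N)
    (f : nat -> Cplx R) (hf : inhomogeneous_Becker k f) :
  regular_seq k f.
Proof.
have [fcvg [d [A [a [a0 _ eqn]]]]] := hf.
pose H := maxn (size A) (\max_(i < d.+1) size (a i)).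
have AH : (size A <= H)%N by exact: leq_maxl.
have aH (i : 'I_d.+1) : (size (a i) <= H)%N.
  have := leq_bigmax (F := fun j : 'I_d.+1 => size (a j)) i.
  by move=> /leq_trans; apply; exact: leq_maxr.
apply: (@recurrence_finite_dimensional (Cplx R) k d H (fun l => - A`_l)
  (fun i l => - (a i.+1)`_l)) => //.
apply/funext => n.
have := Becker_coef n (ltnW hk) aH fcvg eqn.
rewrite big_ord_recl a0 expn0 dilate1 /=.
have H0 : (0 < H)%N by have := aH ord0; rewrite /= a0 size_poly1.
have -> : \sum_(l < H) (1 : {poly Cplx R})`_l *
    shift l f n = f n.
  rewrite (bigD1 (Ordinal H0))//= coef1 mul1r shift0 big1 ?addr0// => l l0.
  by rewrite coef1 -[(l == 0 :> nat)%N]/(l == Ordinal H0) (negPf l0) mul0r.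
have -> : A`_n = \sum_(l < H) A`_l * shift l (delta0 (Cplx R)) n.
  rewrite -[A in LHS]mulr1 (coefM_shift _ _ AH); apply: eq_bigr => l _.
  by rewrite /shift coef1.
move/eqP; rewrite addrCA addr_eq0 => /eqP ->.
rewrite fctE !fct_sumE opprD -!sumrN.
congr (_ + _); apply: eq_bigr => i _; first by rewrite fctE -mulNr.
rewrite fct_sumE -sumrN; apply: eq_bigr => l _.
by rewrite fctE -mulNr.
Qed.
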